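(* Consider a Markov decision process with state space $\mathcal{S}=[0,1]^d$, action space $\mathcal{A}=\mathbb{R}$, environment transition kernel $P(s'\mid s,a)$, discount factor $\gamma\in[0,1)$, horizon $T\in\mathbb{N}\cup\{\infty\}$, and reward function $r:\mathcal{S}\times\mathcal{A}\to[r_{\min},r_{\max}]$ with $|r(s,a)|\le r_{\max}$ for all $(s,a)$. Let $$f(s)=\sum_{i=1}^H W_{2,i}\,\phi\Big(\sum_{k=1}^d W_{1,ik}s_k+b_{1,i}\Big)+b_2$$ be a one-hidden-layer fully connected network, where $\phi:\mathbb{R}\to(a,b)\subseteq\mathbb{R}$ is $L_\phi$-Lipschitz. Fix an input index $j\in\{1,\dots,d\}$ and let $f_p$ be the ''pruned'' network obtained from $f$ by setting $W_{1,ij}=0$ for all $i=1,\dots,H$ (all other parameters unchanged). Let $\sigma_f>0$ and define the Gaussian policies $\pi_\theta(\cdot\mid s)=\mathcal{N}(f(s),\sigma_f^2)$ and $\pi_{\theta_p}(\cdot\mid s)=\mathcal{N}(f_p(s),\sigma_f^2)$. For $i\in\{1,2\}$ (index $1$ for $\pi_\theta$, index $2$ for $\pi_{\theta_p}$), let $p_i(s'\mid s)=\int P(s'\mid s,a)\,\pi_i(a\mid s)\,da$ be the induced state-to-state kernel, let both processes start from the same initial state distribution $p_1^0=p_2^0$, and let $p_i^t$ denote the state distribution at time $t$, i.e. $p_i^t(s')=\int p_i(s'\mid s)p_i^{t-1}(s)\,ds$. Assume $\delta\ge 0$ is such that $\sup_t \mathbb{E}_{s\sim p_1^{t}}\big[D_{TV}(p_1(\cdot\mid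 s)\,\|\,p_2(\cdot\mid s))\big]\le\delta$. Then $$|J(\pi_\theta)-J(\pi_{\theta_p})|\le 2r_{\max}\Big[\frac{\gamma\delta}{(1-\gamma)^2}+\frac{B_j}{\sigma_f(1-\gamma)}\Big],\qquad B_j=L_\phi\sum_{i=1}^H|W_{2,i}W_{1,ij}|.$$
   Context: For a policy $\pi$, $J(\pi)=\mathbb{E}\big[\sum_{t=0}^T\gamma^t r(s_t,a_t)\big]$ where $s_0\sim p^0$, $a_t\sim\pi(\cdot\mid s_t)$, $s_{t+1}\sim P(\cdot\mid s_t,a_t)$. The total variation distance between densities $p,q$ on the same space is $D_{TV}(p\|q)=\frac12\int|p(x)-q(x)|\,dx$. *)

(* Defs.v *)
From HB Require Import structures.
From mathcomp Require Import all_boot all_order all_algebra.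
From mathcomp Require Import all_classical all_reals all_analysis.
Set Implicit Arguments. Unset Strict Implicit. Unset Printing Implicit Defensive.
Import Order.TTheory GRing.Theory Num.Theory.
Local Open Scope classical_set_scope.
Local Open Scope ring_scope.

Section rl_defs.
Context {R : realType} {d : nat}.
(* States are d-tuples of reals; the state space is the cube [0,1]^d. *)
Local Notation S := (d.-tuple R).

Definition cube : set S := [set s | forall k : 'I_d, 0 <= tnth s k <= 1].

Definition net (H : nat) (phi : R -> R) (W1 : 'I_H -> 'I_d -> R)
  (b1 : 'I_H -> R) (W2 : 'I_H -> R) (b2 : R) (s : S) : R :=
  \sum_(i < H) W2 i * phi (\sum_(k < d) W1 i k * tnth s k + b1 i) + b2.

Definition prune (H : nat) (W1 : 'I_H -> 'I_d -> R) (j : 'I_d) :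
  'I_H -> 'I_d -> R := fun i k => if k == j then 0 else W1 i k.

Definition gauss_policy (m : S -> R) (sig : R) (s : S) (a : R) : R :=
  normal_pdf (m s) sig a.

Definition induced_kernel (P : S -> R -> S -> R) (pi : S -> R -> R)
  (s s' : S) : R :=
  \int[@lebesgue_measure R]_(a in setT) (P s a s' * pi s a).

Variable mu : {measure set S -> \bar R}. (* reference measure "ds" *)

Fixpoint state_dist (p0 : S -> R) (k : S -> S -> R) (t : nat) : S -> R :=
  match t with
  | 0 => p0
  | t'.+1 => fun s' => \int[mu]_(s in setT) (k s s' * state_dist p0 k t' s)
  end.

Definition TV (p q : S -> R) : R :=
  2^-1 * \int[mu]_(x in setT) `|p x - q x|.

Definition expected_reward (pt : S -> R) (pi : S -> R -> R)
  (r : S -> R -> R) : R :=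
  \int[mu]_(s in setT)
     (pt s * \int[@lebesgue_measure R]_(a in setT) (pi s a * r s a)).

(* horizon T in N U {oo}: Some T = finite horizon T, None = infinite *)
Definition discounted_sum (T : option nat) (gamma : R) (rt : nat -> R) : R :=
  match T with
  | Some T => \sum_(0 <= t < T.+1) gamma ^+ t * rt t
  | None => limn (fun n => \sum_(0 <= t < n) gamma ^+ t * rt t)
  end.

(* J(pi) = E[ sum_{t=0}^T gamma^t r(s_t, a_t) ], written via the marginal
   state distributions p^t of the trajectory *)
Definition J (T : option nat) (gamma : R) (p0 : S -> R)
  (P : S -> R -> S -> R) (r : S -> R -> R) (pi : S -> R -> R) : R :=
  discounted_sum T gamma
    (fun t => expected_reward (state_dist p0 (induced_kernel P pi) t) pi r).

End rl_defs.

(* Main.v *)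
Require Import Defs.
From HB Require Import structures.
From mathcomp Require Import all_boot all_order all_algebra.
From mathcomp Require Import all_classical all_reals all_analysis.
From mathcomp Require Import measurable_realfun ring lra.
Import Order.TTheory GRing.Theory Num.Theory.
Local Open Scope classical_set_scope.
Local Open Scope ring_scope.

(* Two estimates combine.  Writing [p_t], [q_t] for the two state densities and
   [k], [k'] for the two kernels,
     k p_t - k' q_t = (k - k') p_t + k' (p_t - q_t),
   so one step increases the L^1 distance by at most [2 delta], and
   |p_t - q_t|_1 <= 2 t delta.  Pruning moves the mean of the Gaussian by at
   most [B_j] on the cube, and two Gaussians of equal variance at distance [D]
   are at L^1 distance at most [D / sigma].  The expected rewards at time [t]
   thus differ by at most [rmax * (B_j / sigma + 2 t delta)], and one sums
   against [gamma ^+ t].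

   The hypotheses on [P] and [r] hold only for states in the cube, so both are
   first multiplied by the indicator of the cube, which does not change [J].
   Only the inequality "mass at most 1" is then needed: [Rintegral] sends an
   infinite integral to 0, and [fine x <= x] for [x >= 0], so no almost
   everywhere argument is required. *)

(** * Real-valued integrals compared with extended ones *)

Lemma fine_le_ge0 (R : realType) (x : \bar R) : (0 <= x -> (fine x)%:E <= x)%E.
Proof. by case: x => [x||] //= _; rewrite leey. Qed.

(** If exactly one of [x], [y] is infinite, the triangle inequalities force [z] to be infinite; if
    both are, both [fine] values are 0. This lets real-valued integrals be compared before they are
    known to be finite. *)
Lemma fine_dist_le (R : realType) (x y z : \bar R) :
  (0 <= x -> 0 <= y -> 0 <= z -> x <= y + z -> y <= x + z ->
   `|fine x - fine y|%:E <= z)%E.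
Proof.
case: x => [x||] //; case: y => [y||] //; case: z => [z||] //= _ _;
  rewrite ?leey// ?lee_fin => z0 h1 h2; rewrite ?subrr ?normr0//.
by rewrite ler_norml; apply/andP; split; lra.
Qed.

Section real_integrals.
Context {dT : measure_display} {T : measurableType dT} {R : realType}.
Variable mu : {measure set T -> \bar R}.
Implicit Types f g : T -> R.

Lemma Rintegral_eq0 f : (forall x, f x = 0) -> \int[mu]_x f x = 0.
Proof.
by move=> f0; rewrite /Rintegral; under eq_integral do rewrite f0; rewrite integral0.
Qed.

(** Nonnegativity allows [f <= g + |f - g|] and its mirror image to be integrated in the extended
    reals, infinite values included; [fine_dist_le] then returns to the reals. *)
Lemma Rintegral_dist_le f g :
  measurable_fun setT f -> measurable_fun setT g ->
  (forall x, 0 <= f x) -> (forall x, 0 <= g x) ->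
  (`|\int[mu]_x f x - \int[mu]_x g x|%:E <= \int[mu]_x `|f x - g x|%:E)%E.
Proof.
move=> mf mg f0 g0.
have half f' g' : measurable_fun setT f' -> measurable_fun setT g' ->
    (forall x, 0 <= f' x) -> (forall x, 0 <= g' x) ->
    (\int[mu]_x (f' x)%:E <=
     \int[mu]_x (g' x)%:E + \int[mu]_x `|f' x - g' x|%:E)%E.
  move=> mf' mg' f'0 g'0.
  have mD : measurable_fun setT (fun x => `|f' x - g' x|).
    by apply: measurableT_comp => //; exact: measurable_funB.
  rewrite -ge0_integralD//; [|by move=> x _; rewrite lee_fin|
    exact/measurable_EFinP|exact/measurable_EFinP].
  apply: ge0_le_integral => //; first by move=> x _; rewrite lee_fin.
  - exact/measurable_EFinP.
  - by apply: emeasurable_funD; exact/measurable_EFinP.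
  - by move=> x _; rewrite lee_fin -lerBlDl; exact: ler_norm.
rewrite /Rintegral; apply: fine_dist_le.
- by apply: integral_ge0 => x _; rewrite lee_fin.
- by apply: integral_ge0 => x _; rewrite lee_fin.
- by apply: integral_ge0 => x _; rewrite lee_fin.
- exact: half.
- under [X in (_ <= _ + X)%E]eq_integral do rewrite distrC.
  exact: half.
Qed.

Lemma integrable_le_fin f (c : R) : measurable_fun setT f ->
  (\int[mu]_x `|f x|%:E <= c%:E)%E -> mu.-integrable setT (EFin \o f).
Proof.
move=> mf fc; apply/integrableP; split; first exact/measurable_EFinP.
exact: le_lt_trans fc (ltry _).
Qed.

Lemma Rintegral_norm_le f (c : R) : measurable_fun setT f ->
  (\int[mu]_x `|f x|%:E <= c%:E)%E -> `|\int[mu]_x f x| <= c.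
Proof.
move=> mf fc; have fint := integrable_le_fin f c mf fc.
rewrite -lee_fin (le_trans _ fc)// EFin_normr_Rintegral//.
by apply: le_abse_integral => //; exact/measurable_EFinP.
Qed.

End real_integrals.

(** * The L^1 distance between Gaussians of equal variance *)

Section gaussian.
Context {R : realType}.
Implicit Types m s x : R.

(** Parallelogram identity in the exponent: [(x - m)^2 + (x - m')^2] is twice the squared distance
    from [x] to the midpoint of the means, plus [(m - m')^2 / 2]. *)
Lemma normal_pdf_mean_eq m m' s x : s != 0 ->
  normal_pdf ((m + m') / 2) s x ^+ 2 * expR (- (m - m') ^+ 2 / (s ^+ 2 * 4)) =
  normal_pdf m s x * normal_pdf m' s x.
Proof.
move=> s0; rewrite !normal_pdfE// /normal_fun exprMn.
rewrite [RHS]mulrACA -expr2 -mulrA; congr (_ * _).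
rewrite expr2 -!expRD; congr expR; rewrite -[s ^+ 2 *+ 2]mulr_natr; field.
exact: s0.
Qed.

(* Hellinger affinity bound: with [u ^+ 2] and [v ^+ 2] the two densities, their
   difference is [(u - v) * (u + v)], and [u * v] is a Gaussian density up to a
   constant, so AM-GM with weight [c] reduces everything to total masses. *)
Lemma normal_pdf_dist_le m m' s c x : s != 0 -> 0 < c ->
  `|normal_pdf m s x - normal_pdf m' s x| <=
  c / 2 * (normal_pdf m s x + normal_pdf m' s x
    - 2 * expR (- (m - m') ^+ 2 / (s ^+ 2 * 8)) * normal_pdf ((m + m') / 2) s x)
  + c^-1 * (normal_pdf m s x + normal_pdf m' s x).
Proof.
move=> s0 c0; have := normal_pdf_mean_eq m m' s x s0.
have := normal_pdf_ge0 m s x; have := normal_pdf_ge0 m' s x.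
have := normal_pdf_ge0 ((m + m') / 2) s x.
set p := normal_pdf m s x; set q := normal_pdf m' s x.
set g := normal_pdf _ s x; move=> g0 q0 p0 gE.
set e := expR _.
have e2 : expR (- (m - m') ^+ 2 / (s ^+ 2 * 4)) = e ^+ 2.
  by rewrite [RHS]expr2 /e -expRD; congr expR; field; exact: s0.
have e0 : 0 <= e by exact: expR_ge0.
pose u := Num.sqrt p; pose v := Num.sqrt q.
have u0 : 0 <= u by exact: sqrtr_ge0.
have v0 : 0 <= v by exact: sqrtr_ge0.
have uE : p = u ^+ 2 by rewrite sqr_sqrtr.
have vE : q = v ^+ 2 by rewrite sqr_sqrtr.
have uvE : e * g = u * v.
  apply/eqP; rewrite -(@eqrXn2 _ 2)// ?mulr_ge0//; apply/eqP.
  by rewrite !exprMn -uE -vE -gE e2 mulrC.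
rewrite -[2 * e * g]mulrA uvE uE vE subr_sqr normrM (ger0_norm (addr_ge0 u0 v0)).
have ic0 : 0 < c^-1 by rewrite invr_gt0.
have cV : c * c^-1 = 1 by rewrite divff// gt_eqF.
(* AM-GM: this square bounds [2 |u - v| (u + v)] by [c (u - v)^2 + (u + v)^2 / c]. Since
   [(u + v)^2 = 2 (u^2 + v^2) - (u - v)^2], the fact [h2] then removes the last square. *)
have key : 0 <= (c * `|u - v| - (u + v)) ^+ 2 * c^-1.
  by rewrite mulr_ge0 ?sqr_ge0// ltW.
have h2 : 0 <= c^-1 * (u - v) ^+ 2 by rewrite mulr_ge0 ?sqr_ge0// ltW.
have n2 : `|u - v| ^+ 2 = (u - v) ^+ 2 by rewrite real_normK// num_real.
have keyE : (c * `|u - v| - (u + v)) ^+ 2 * c^-1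
   = c * (u - v) ^+ 2 - 2 * `|u - v| * (u + v) + c^-1 * (u + v) ^+ 2.
  rewrite -n2; have c00 : c != 0 by rewrite gt_eqF.
  by field.
rewrite keyE in key.
by move: key h2; rewrite !expr2; nra.
Qed.

Lemma integral_normal_pdf_dist_le m m' s : 0 < s ->
  (\int[lebesgue_measure]_x `|normal_pdf m s x - normal_pdf m' s x|%:E
   <= (`|m - m'| / s)%:E)%E.
Proof.
move=> s0; have s00 : s != 0 by rewrite gt_eqF.
(* Equal means are treated apart, because the weight chosen below divides by [D]. *)
have [->|mm'] := eqVneq m m'.
  under eq_integral do rewrite subrr normr0.
  by rewrite integral0 subrr normr0 mul0r.
pose D := `|m - m'|.
have D0 : 0 < D by rewrite normr_gt0 subr_eq0.
(* After integration the bound is [c (1 - e) + 2 / c], and [1 + x <= exp x] gives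
   [1 - e <= D^2 / (8 s^2)]. This [c] minimizes [c D^2 / (8 s^2) + 2 / c]: both terms become
   [D / (2 s)]. *)
pose c := 4 * s / D.
have c0 : 0 < c by rewrite divr_gt0// mulr_gt0.
pose e := expR (- (m - m') ^+ 2 / (s ^+ 2 * 8)).
pose F x := c / 2 * (normal_pdf m s x + normal_pdf m' s x
  - 2 * e * normal_pdf ((m + m') / 2) s x)
  + c^-1 * (normal_pdf m s x + normal_pdf m' s x).
have FE x : F x = (c / 2 + c^-1) * normal_pdf m s x +
   (c / 2 + c^-1) * normal_pdf m' s x - c * e * normal_pdf ((m + m') / 2) s x.
  by rewrite /F; field; rewrite gt_eqF.
have iZ k n : (@lebesgue_measure R).-integrable setT
    (EFin \o (fun x => k * normal_pdf n s x)).
  apply: eq_integrable (integrableZl _ k (integrable_normal_pdf n s)) => //.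
have IZ k n : (\int[lebesgue_measure]_x (k * normal_pdf n s x)%:E = k%:E)%E.
  under eq_integral do rewrite EFinM.
  rewrite integralZl//; last exact: integrable_normal_pdf.
  by rewrite integral_normal_pdf mule1.
have mF : measurable_fun setT F.
  rewrite (funext FE).
  by apply: measurable_funB; [apply: measurable_funD|];
    apply: measurable_funM => //; exact: measurable_normal_pdf.
apply: (@le_trans _ _ (\int[lebesgue_measure]_x (F x)%:E)%E).
  apply: ge0_le_integral => //.
  - apply/measurable_EFinP; apply: measurableT_comp => //.
    by apply: measurable_funB; exact: measurable_normal_pdf.
  - exact/measurable_EFinP.
  - by move=> x _; rewrite lee_fin; exact: normal_pdf_dist_le.
under eq_integral do rewrite FE EFinB EFinD.
rewrite integralB//=; last first.
- exact: iZ.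
- by apply: integrableD => //; exact: iZ.
rewrite integralD//=; [|exact: iZ|exact: iZ].
rewrite !IZ -(EFinD (c / 2 + c^-1)) -EFinB lee_fin.
have De : 1 - D ^+ 2 / (s ^+ 2 * 8) <= e.
  rewrite (le_trans _ (expR_ge1Dx _))// mulNr real_normK ?num_real//.
have -> : c / 2 + c^-1 + (c / 2 + c^-1) - c * e = c * (1 - e) + 2 * c^-1.
  by field; rewrite gt_eqF.
have h : c * (1 - e) <= c * (D ^+ 2 / (s ^+ 2 * 8)).
  by rewrite ler_pM2l//; lra.
apply: (le_trans (lerD h (lexx _))).
rewrite le_eqVlt; apply/orP; left; apply/eqP; rewrite -/D /c.
by field; rewrite s00 gt_eqF.
Qed.

End gaussian.

(** * Substochastic kernels and the drift of state distributions *)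

Section substochastic.
Context {R : realType} {n : nat}.
Local Notation S := (n.-tuple R).
Variable mu : {sigma_finite_measure set S -> \bar R}.
Implicit Types (p q : S -> R) (k : S -> S -> R).

Definition subprob p := [/\ measurable_fun setT p, forall s, 0 <= p s &
  (\int[mu]_s (p s)%:E <= 1)%E].

(** Null rows are allowed, so that a kernel cut off outside the cube still qualifies. *)
Definition substoch k := [/\ measurable_fun setT (fun x : S * S => k x.1 x.2),
  forall s s', 0 <= k s s' & forall s, (\int[mu]_s' (k s s')%:E <= 1)%E].

Lemma measurable_kernel_row k s :
  measurable_fun setT (fun x : S * S => k x.1 x.2) -> measurable_fun setT (k s).
Proof.
by move=> mk; exact: (measurable_fun_pair2 s mk).
Qed.

Lemma measurable_kernel_col k s' :
  measurable_fun setT (fun x : S * S => k x.1 x.2) ->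
  measurable_fun setT (k ^~ s').
Proof.
by move=> mk; exact: (measurable_fun_pair1 s' mk).
Qed.

Lemma measurable_kernelM k p :
  measurable_fun setT (fun x : S * S => k x.1 x.2) -> measurable_fun setT p ->
  measurable_fun setT (fun x : S * S => k x.2 x.1 * p x.2).
Proof.
move=> mk mp; apply: measurable_funM; last first.
  by apply: measurableT_comp => //; exact: measurable_snd.
have mg : measurable_fun setT (fun x : S * S => (x.2, x.1)).
  by apply: measurable_fun_pair; [exact: measurable_snd|exact: measurable_fst].
exact: (measurableT_comp mk mg).
Qed.

(** Tonelli, with [p s] pulled out of the inner integral. It reduces estimates for one step of the
    chain to estimates on the rows of the kernel. *)
Lemma integral_mixture k p :
  measurable_fun setT (fun x : S * S => k x.1 x.2) -> measurable_fun setT p ->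
  (forall s s', 0 <= k s s') -> (forall s, 0 <= p s) ->
  (\int[mu]_s' \int[mu]_s (k s s' * p s)%:E =
   \int[mu]_s ((p s)%:E * \int[mu]_s' (k s s')%:E))%E.
Proof.
move=> mk mp k0 p0.
rewrite (@fubini_tonelli _ _ _ _ _ mu mu (fun x : S * S => (k x.2 x.1 * p x.2)%:E))//=.
- apply: eq_integral => s _; under eq_integral do rewrite mulrC EFinM.
  rewrite ge0_integralZl_EFin//.
  + by move=> s' _; rewrite lee_fin.
  + by apply/measurable_EFinP; exact: measurable_kernel_row.
- by apply/measurable_EFinP; exact: measurable_kernelM.
- by move=> x; rewrite lee_fin mulr_ge0.
Qed.

Lemma measurable_mixture k p :
  measurable_fun setT (fun x : S * S => k x.1 x.2) -> measurable_fun setT p ->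
  (forall s s', 0 <= k s s') -> (forall s, 0 <= p s) ->
  measurable_fun setT (fun s' => (\int[mu]_s (k s s' * p s)%:E)%E).
Proof.
move=> mk mp k0 p0.
apply: (@measurable_fun_fubini_tonelli_F _ _ _ _ _ mu
  (fun x : S * S => (k x.2 x.1 * p x.2)%:E)).
- by apply/measurable_EFinP; exact: measurable_kernelM.
- by move=> x; rewrite lee_fin mulr_ge0.
Qed.

Lemma measurable_row_mass k :
  measurable_fun setT (fun x : S * S => k x.1 x.2) -> (forall s s', 0 <= k s s') ->
  measurable_fun setT (fun s => (\int[mu]_s' (k s s')%:E)%E).
Proof.
move=> mk k0.
apply: (@measurable_fun_fubini_tonelli_F _ _ _ _ _ mu
  (fun x : S * S => (k x.1 x.2)%:E)).
- exact/measurable_EFinP.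
- by move=> x; rewrite lee_fin.
Qed.

Lemma subprob_step k p : substoch k -> subprob p ->
  subprob (fun s' => \int[mu]_s (k s s' * p s)).
Proof.
move=> [mk k0 k1] [mp p0 p1].
have mI := measurable_mixture k p mk mp k0 p0.
have mF : measurable_fun setT (fun s' => \int[mu]_s (k s s' * p s)).
  exact: measurableT_comp.
have I0 s' : (0 <= \int[mu]_s (k s s' * p s)%:E)%E.
  by apply: integral_ge0 => s _; rewrite lee_fin mulr_ge0.
split=> //; first by move=> s'; apply: fine_ge0.
(* Where the inner integral is infinite the new density is 0, so passing to real values can only
   lose mass. *)
apply: (@le_trans _ _ (\int[mu]_s' \int[mu]_s (k s s' * p s)%:E)%E).
  apply: ge0_le_integral => //.
  - by move=> s' _; rewrite lee_fin fine_ge0.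
  - exact/measurable_EFinP.
  - by move=> s' _; exact: fine_le_ge0.
rewrite integral_mixture//; apply: le_trans p1.
apply: ge0_le_integral => //.
- move=> s _; rewrite mule_ge0 ?lee_fin//.
  by apply: integral_ge0 => s' _; rewrite lee_fin.
- apply: emeasurable_funM; first exact/measurable_EFinP.
  exact: measurable_row_mass.
- exact/measurable_EFinP.
- by move=> s _; rewrite -[leRHS]mule1 lee_wpmul2l// lee_fin.
Qed.

Lemma subprob_state_dist k p t : substoch k -> subprob p ->
  subprob (state_dist mu p k t).
Proof. by move=> hk hp; elim: t => [//|t IH] /=; exact: subprob_step. Qed.

Lemma measurable_dist k k' : substoch k -> substoch k' ->
  measurable_fun setT (fun x : S * S => `|k x.1 x.2 - k' x.1 x.2|).
Proof.
move=> [mk _ _] [mk' _ _].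
by apply: measurableT_comp => //; exact: measurable_funB.
Qed.

(** The kernel difference is weighted by [p], the law of the first process, because the total
    variation assumption is an average along that process only. The second kernel acts on [p - q] as
    an L^1 contraction. *)
Lemma step_dist_le k k' p q : substoch k -> substoch k' ->
  subprob p -> subprob q ->
  (\int[mu]_s' `|\int[mu]_s (k s s' * p s) - \int[mu]_s (k' s s' * q s)|%:E <=
   \int[mu]_s ((p s)%:E * \int[mu]_s' `|k s s' - k' s s'|%:E) +
   \int[mu]_s `|p s - q s|%:E)%E.
Proof.
move=> hk hk' hp hq; have mkk' := measurable_dist k k' hk hk'.
have [mstep _ _] := subprob_step k p hk hp.
have [mstep' _ _] := subprob_step k' q hk' hq.
move: hk hk' hp hq => [mk k0 k1] [mk' k'0 k'1] [mp p0 p1] [mq q0 q1].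
have mpq : measurable_fun setT (fun s => `|p s - q s|).
  by apply: measurableT_comp => //; exact: measurable_funB.
have mI := measurable_mixture (fun s s' => `|k s s' - k' s s'|) p mkk' mp
  (fun _ _ => normr_ge0 _) p0.
have mI' := measurable_mixture k' (fun s => `|p s - q s|) mk' mpq k'0
  (fun _ => normr_ge0 _).
apply: (@le_trans _ _ (\int[mu]_s'
   (\int[mu]_s (`|k s s' - k' s s'| * p s)%:E +
    \int[mu]_s (k' s s' * `|p s - q s|)%:E))%E).
  apply: ge0_le_integral => //.
  - by apply/measurable_EFinP; apply: measurableT_comp => //; exact: measurable_funB.
  - exact: emeasurable_funD.
  - move=> s' _.
    have mks' := measurable_kernel_col k s' mk.
    have mk's' := measurable_kernel_col k' s' mk'.
    have mds' : measurable_fun setT (fun s => `|k s s' - k' s s'|).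
      by apply: measurableT_comp => //; exact: measurable_funB.
    apply: (le_trans (Rintegral_dist_le mu (fun s => k s s' * p s)
      (fun s => k' s s' * q s) _ _ _ _)).
    + exact: measurable_funM.
    + exact: measurable_funM.
    + by move=> s; rewrite mulr_ge0.
    + by move=> s; rewrite mulr_ge0.
    rewrite -ge0_integralD//; last first.
    + by apply/measurable_EFinP; exact: measurable_funM.
    + by move=> s _; rewrite lee_fin mulr_ge0.
    + by apply/measurable_EFinP; exact: measurable_funM.
    + by move=> s _; rewrite lee_fin mulr_ge0.
    apply: ge0_le_integral => //.
    + apply/measurable_EFinP; apply: measurableT_comp => //.
      by apply: measurable_funB; exact: measurable_funM.
    + by apply: emeasurable_funD; apply/measurable_EFinP; exact: measurable_funM.
    + move=> s _; rewrite lee_fin.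
      have -> : k s s' * p s - k' s s' * q s =
        (k s s' - k' s s') * p s + k' s s' * (p s - q s) by ring.
      rewrite (le_trans (ler_normD _ _))// !normrM (ger0_norm (p0 s)).
      by rewrite (ger0_norm (k'0 s s')).
rewrite ge0_integralD//; last first.
- by move=> s' _; apply: integral_ge0 => s _; rewrite lee_fin mulr_ge0.
- by move=> s' _; apply: integral_ge0 => s _; rewrite lee_fin mulr_ge0.
rewrite (integral_mixture (fun s s' => `|k s s' - k' s s'|))//.
rewrite (integral_mixture k' (fun s => `|p s - q s|))//.
rewrite leeD2l//; apply: ge0_le_integral => //.
- move=> s _; rewrite mule_ge0 ?lee_fin//.
  by apply: integral_ge0 => s' _; rewrite lee_fin.
- apply: emeasurable_funM; first exact/measurable_EFinP.
  exact: measurable_row_mass.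
- exact/measurable_EFinP.
- by move=> s _; rewrite -[leRHS]mule1 lee_wpmul2l// lee_fin.
Qed.

(** The common initial law makes the distance 0 at time 0, and each step adds at most [c]. *)
Lemma state_dist_dist_le k k' p (c : R) t : substoch k -> substoch k' ->
  subprob p ->
  (forall t, \int[mu]_s ((state_dist mu p k t s)%:E *
    \int[mu]_s' `|k s s' - k' s s'|%:E) <= c%:E)%E ->
  (\int[mu]_s `|state_dist mu p k t s - state_dist mu p k' t s|%:E
   <= (t%:R * c)%:E)%E.
Proof.
move=> hk hk' hp hc; elim: t => [|t IH] /=.
  by under eq_integral do rewrite subrr normr0; rewrite integral0 mul0r.
apply: (le_trans (step_dist_le k k' _ _ hk hk' (subprob_state_dist k p t hk hp)
  (subprob_state_dist k' p t hk' hp))).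
by rewrite -natr1 mulrDl mul1r addrC EFinD leeD.
Qed.

(** [TV] would read 0 if its integral were infinite. Row masses at most 1 keep that integral below
    2, so [TV] is the genuine half L^1 distance. *)
Lemma integral_dist_TV k k' s : substoch k -> substoch k' ->
  (\int[mu]_s' `|k s s' - k' s s'|%:E)%E = (2 * TV mu (k s) (k' s))%:E /\
  0 <= TV mu (k s) (k' s) <= 1.
Proof.
move=> hk hk'; have mkk' := measurable_dist k k' hk hk'.
move: hk hk' => [mk k0 k1] [mk' k'0 k'1].
have mks := measurable_kernel_row k s mk.
have mk's := measurable_kernel_row k' s mk'.
have I2 : (\int[mu]_s' `|k s s' - k' s s'|%:E <= 2%:E)%E.
  rewrite (_ : 2%:E = 1 + 1)%E; last by rewrite -EFinD.
  apply: (le_trans _ (leeD (k1 s) (k'1 s))).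
  rewrite -ge0_integralD//; last first.
  - exact/measurable_EFinP.
  - by move=> s' _; rewrite lee_fin.
  - exact/measurable_EFinP.
  - by move=> s' _; rewrite lee_fin.
  apply: ge0_le_integral => //.
  - apply/measurable_EFinP; apply: measurableT_comp => //.
    exact: measurable_funB.
  - by apply: emeasurable_funD; exact/measurable_EFinP.
  - move=> s' _; rewrite lee_fin (le_trans (ler_normB _ _))//.
    by rewrite !ger0_norm.
have I0 : (0 <= \int[mu]_s' `|k s s' - k' s s'|%:E)%E by exact: integral_ge0.
have If : (\int[mu]_s' `|k s s' - k' s s'|%:E)%E \is a fin_num.
  by rewrite ge0_fin_numE// (le_lt_trans I2)// ltry.
rewrite /TV /Rintegral mulrA divff// mul1r fineK//; split=> //.
have := fine_ge0 I0; move: I2; rewrite -{1}(fineK If) lee_fin.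
by move=> ? ?; apply/andP; split; lra.
Qed.

Lemma measurable_TV k k' : substoch k -> substoch k' ->
  measurable_fun setT (fun s => TV mu (k s) (k' s)).
Proof.
move=> hk hk'; apply: measurable_funM => //.
apply: measurableT_comp => //.
by apply: (measurable_row_mass (fun s s' => `|k s s' - k' s s'|)) => //; exact: measurable_dist.
Qed.

(** The assumption bounds a real-valued integral and says nothing if the extended one is infinite.
    Since [TV] is at most 1 and [p] has mass at most 1, it is finite and the bound transfers. *)
Lemma integral_TV_le k k' p (c : R) : substoch k -> substoch k' -> subprob p ->
  \int[mu]_s (p s * TV mu (k s) (k' s)) <= c ->
  (\int[mu]_s ((p s)%:E * \int[mu]_s' `|k s s' - k' s s'|%:E) <= (2 * c)%:E)%E.
Proof.
move=> hk hk' [mp p0 p1] hc.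
have mTV := measurable_TV k k' hk hk'.
have TV0 s : 0 <= TV mu (k s) (k' s) <= 1.
  by have [] := integral_dist_TV k k' s hk hk'.
under eq_integral => s _.
  rewrite (integral_dist_TV k k' s hk hk').1 -EFinM mulrCA EFinM.
  over.
have pTV0 s : 0 <= p s * TV mu (k s) (k' s).
  by rewrite mulr_ge0//; case/andP: (TV0 s).
have mpTV : measurable_fun setT (fun s => p s * TV mu (k s) (k' s)).
  exact: measurable_funM.
rewrite ge0_integralZl_EFin//; last first.
- exact/measurable_EFinP.
- by move=> s _; rewrite lee_fin.
rewrite EFinM lee_wpmul2l ?lee_fin//; move: hc; rewrite -lee_fin; apply: le_trans.
rewrite /Rintegral fineK//.
rewrite ge0_fin_numE//; last by apply: integral_ge0 => s _; rewrite lee_fin.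
apply: (@le_lt_trans _ _ 1%E); last exact: ltry.
apply: le_trans p1; apply: ge0_le_integral => //.
- by move=> s _; rewrite lee_fin.
- exact/measurable_EFinP.
- exact/measurable_EFinP.
- move=> s _; rewrite lee_fin -[leRHS]mulr1 ler_wpM2l//.
  by case/andP: (TV0 s).
Qed.

End substochastic.

(** * Policies, induced kernels and expected rewards *)

Section reward_gap.
Context {R : realType} {n : nat}.
Local Notation S := (n.-tuple R).
Variable mu : {sigma_finite_measure set S -> \bar R}.

(** Rewards may be negative, so Tonelli is applied to the positive and negative parts separately;
    the integral is by definition their difference. *)
Lemma measurable_integral_snd {d1 d2 : measure_display} {T1 : measurableType d1}
    {T2 : measurableType d2} (nu : {sigma_finite_measure set T2 -> \bar R})
    (f : T1 * T2 -> \bar R) :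
  measurable_fun setT f -> measurable_fun setT (fun x => (\int[nu]_y f (x, y))%E).
Proof.
move=> mf; rewrite (_ : (fun x => _) =
    fun x => (fubini_F nu f^\+ x - fubini_F nu f^\- x)%E); last first.
  apply/funext => x; rewrite /fubini_F [LHS]integralE.
  by congr (_ - _)%E; apply: eq_integral => y _; rewrite ?funeposE ?funenegE.
apply: emeasurable_funB; apply: measurable_fun_fubini_tonelli_F => //.
- exact: measurable_funepos.
- exact: measurable_funeneg.
Qed.

Definition subpolicy (pi : S -> R -> R) :=
  [/\ measurable_fun setT (fun x : S * R => pi x.1 x.2), forall s a, 0 <= pi s a &
      forall s, (\int[lebesgue_measure]_a (pi s a)%:E <= 1)%E].

Lemma substoch_induced_kernel (P : S -> R -> S -> R) (pi : S -> R -> R) :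
  measurable_fun setT (fun x : (S * R) * S => P x.1.1 x.1.2 x.2) ->
  (forall s a s', 0 <= P s a s') ->
  (forall s a, (\int[mu]_s' (P s a s')%:E <= 1)%E) ->
  subpolicy pi -> substoch mu (induced_kernel P pi).
Proof.
move=> mP P0 P1 [mpi pi0 pi1].
have mPpi : measurable_fun setT
    (fun x : (S * S) * R => (P x.1.1 x.2 x.1.2 * pi x.1.1 x.2)%:E).
  apply/measurable_EFinP; apply: measurable_funM.
  - have mg : measurable_fun setT
        (fun x : (S * S) * R => ((x.1.1, x.2), x.1.2)).
      apply: measurable_fun_pair; first apply: measurable_fun_pair.
      + exact: (measurableT_comp measurable_fst measurable_fst).
      + exact: measurable_snd.
      + exact: (measurableT_comp measurable_snd measurable_fst).
    exact: (measurableT_comp mP mg).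
  - have mg : measurable_fun setT (fun x : (S * S) * R => (x.1.1, x.2)).
      apply: measurable_fun_pair.
      + exact: (measurableT_comp measurable_fst measurable_fst).
      + exact: measurable_snd.
    exact: (measurableT_comp mpi mg).
have mI := measurable_integral_snd lebesgue_measure _ mPpi.
have mk : measurable_fun setT (fun x : S * S => induced_kernel P pi x.1 x.2).
  exact: measurableT_comp.
have I0 s s' : (0 <= \int[lebesgue_measure]_a (P s a s' * pi s a)%:E)%E.
  by apply: integral_ge0 => a _; rewrite lee_fin mulr_ge0.
have k0 s s' : 0 <= induced_kernel P pi s s' by exact: fine_ge0.
split=> // s.
have mPs : measurable_fun setT
    (fun x : S * R => (P s x.2 x.1 * pi s x.2)%:E).
  have mg : measurable_fun setT (fun x : S * R => ((s, x.1), x.2)).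
    apply: measurable_fun_pair; last exact: measurable_snd.
    by apply: measurable_fun_pair => //; exact: measurable_fst.
  exact: (measurableT_comp mPpi mg).
apply: (@le_trans _ _ (\int[mu]_s'
    \int[lebesgue_measure]_a (P s a s' * pi s a)%:E)%E).
  apply: ge0_le_integral => //.
  - by move=> s' _; rewrite lee_fin.
  - by apply/measurable_EFinP; exact: (measurable_kernel_row _ s mk).
  - exact: (measurable_integral_snd lebesgue_measure _ mPs).
  - by move=> s' _; exact: fine_le_ge0.
(* Integrating over the next state first uses up the mass of [P s a] and leaves the mass of the
   policy. *)
rewrite (@fubini_tonelli _ _ _ _ _ mu lebesgue_measure
  (fun x : S * R => (P s x.2 x.1 * pi s x.2)%:E))//=; last first.
  by move=> x; rewrite lee_fin mulr_ge0.
have mPsa a : measurable_fun setT (P s a).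
  exact: (measurable_fun_pair2 (s, a) mP).
have mpis : measurable_fun setT (pi s) by exact: (measurable_fun_pair2 s mpi).
apply: le_trans (pi1 s); apply: ge0_le_integral => //.
- by move=> a _; apply: integral_ge0 => s' _; rewrite lee_fin mulr_ge0.
- have mswap : measurable_fun setT (fun x : R * S => (P s x.1 x.2 * pi s x.1)%:E).
    have mg : measurable_fun setT (fun x : R * S => (x.2, x.1)).
      by apply: measurable_fun_pair; [exact: measurable_snd|exact: measurable_fst].
    exact: (measurableT_comp mPs mg).
  exact: (measurable_integral_snd mu _ mswap).
- exact/measurable_EFinP.
- move=> a _; under eq_integral do rewrite mulrC EFinM.
  rewrite ge0_integralZl_EFin//; last first.
  + exact/measurable_EFinP.
  + by move=> s' _; rewrite lee_fin.
  by rewrite -[leRHS]mule1 lee_wpmul2l// lee_fin.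
Qed.

Section mean_reward.
Variables (pi : S -> R -> R) (r : S -> R -> R) (M : R).
Hypothesis pi_pol : subpolicy pi.
Hypothesis mr : measurable_fun setT (fun x : S * R => r x.1 x.2).
Hypothesis rM : forall s a, `|r s a| <= M.

Lemma measurable_mean_reward :
  measurable_fun setT (fun s => \int[lebesgue_measure]_a (pi s a * r s a)).
Proof.
have [mpi _ _] := pi_pol; apply: measurableT_comp => //.
apply: (measurable_integral_snd lebesgue_measure
  (fun x : S * R => (pi x.1 x.2 * r x.1 x.2)%:E)).
by apply/measurable_EFinP; exact: measurable_funM.
Qed.

Lemma mean_reward_integral_le s :
  (\int[lebesgue_measure]_a `|pi s a * r s a|%:E <= M%:E)%E.
Proof.
have [mpi pi0 pi1] := pi_pol.
have M0 : 0 <= M by exact: le_trans (normr_ge0 _) (rM s 0).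
have mpis : measurable_fun setT (pi s) by exact: (measurable_fun_pair2 s mpi).
have mrs : measurable_fun setT (r s) by exact: (measurable_fun_pair2 s mr).
apply: (@le_trans _ _ (\int[lebesgue_measure]_a (M%:E * (pi s a)%:E))%E).
  apply: ge0_le_integral => //.
  - apply/measurable_EFinP; apply: measurableT_comp => //.
    exact: measurable_funM.
  - by apply/measurable_EFinP; exact: measurable_funM.
  - move=> a _; rewrite -EFinM lee_fin normrM (ger0_norm (pi0 s a)) mulrC.
    by rewrite ler_wpM2r.
rewrite ge0_integralZl_EFin//; last first.
- exact/measurable_EFinP.
- by move=> a _; rewrite lee_fin.
by rewrite -[leRHS]mule1 lee_wpmul2l// lee_fin.
Qed.

Lemma mean_reward_integrable s :
  (@lebesgue_measure R).-integrable setT (EFin \o (fun a => pi s a * r s a)).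
Proof.
have [mpi pi0 pi1] := pi_pol.
have mpis : measurable_fun setT (pi s) by exact: (measurable_fun_pair2 s mpi).
have mrs : measurable_fun setT (r s) by exact: (measurable_fun_pair2 s mr).
apply: (integrable_le_fin _ _ M); first exact: measurable_funM.
exact: mean_reward_integral_le.
Qed.

Lemma mean_reward_le s : `|\int[lebesgue_measure]_a (pi s a * r s a)| <= M.
Proof.
have [mpi pi0 pi1] := pi_pol.
have mpis : measurable_fun setT (pi s) by exact: (measurable_fun_pair2 s mpi).
have mrs : measurable_fun setT (r s) by exact: (measurable_fun_pair2 s mr).
apply: Rintegral_norm_le; first exact: measurable_funM.
exact: mean_reward_integral_le.
Qed.

End mean_reward.

Lemma mean_reward_dist_le (pi pi' r : S -> R -> R) (M c : R) s :
  subpolicy pi -> subpolicy pi' ->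
  measurable_fun setT (fun x : S * R => r x.1 x.2) ->
  (forall s a, `|r s a| <= M) ->
  (\int[lebesgue_measure]_a `|pi s a - pi' s a|%:E <= c%:E)%E ->
  `|\int[lebesgue_measure]_a (pi s a * r s a) -
    \int[lebesgue_measure]_a (pi' s a * r s a)| <= M * c.
Proof.
move=> hpi hpi' mr rM hc.
have M0 : 0 <= M by exact: le_trans (normr_ge0 _) (rM s 0).
rewrite -RintegralB//; [|exact: (mean_reward_integrable _ _ M)|
  exact: (mean_reward_integrable _ _ M)].
have [mpi pi0 pi1] := hpi; have [mpi' pi0' pi1'] := hpi'.
have mpis : measurable_fun setT (pi s) by exact: (measurable_fun_pair2 s mpi).
have mpis' : measurable_fun setT (pi' s) by exact: (measurable_fun_pair2 s mpi').
have mrs : measurable_fun setT (r s) by exact: (measurable_fun_pair2 s mr).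
apply: Rintegral_norm_le.
  by apply: measurable_funB; exact: measurable_funM.
have mD : measurable_fun setT (fun a => `|pi s a - pi' s a|).
  by apply: measurableT_comp => //; exact: measurable_funB.
apply: (@le_trans _ _ (\int[lebesgue_measure]_a (M%:E * `|pi s a - pi' s a|%:E))%E).
  apply: ge0_le_integral => //.
  - apply/measurable_EFinP; apply: measurableT_comp => //.
    by apply: measurable_funB; exact: measurable_funM.
  - by apply/measurable_EFinP; exact: measurable_funM.
  - by move=> a _; rewrite -EFinM lee_fin -mulrBl normrM mulrC ler_wpM2r.
rewrite ge0_integralZl_EFin//; last exact/measurable_EFinP.
by rewrite EFinM lee_wpmul2l// lee_fin.
Qed.

Section expectation.
Variables (p : S -> R) (u : S -> R) (M : R).
Hypothesis hp : subprob mu p.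
Hypothesis mu_ : measurable_fun setT u.
Hypothesis uM : forall s, `|u s| <= M.

Lemma expectation_integral_le : (\int[mu]_s `|p s * u s|%:E <= M%:E)%E.
Proof.
have [mp p0 p1] := hp.
have M0 : 0 <= M by exact: le_trans (normr_ge0 _) (uM (nseq_tuple _ 0)).
apply: (@le_trans _ _ (\int[mu]_s (M%:E * (p s)%:E))%E).
  apply: ge0_le_integral => //.
  - apply/measurable_EFinP; apply: measurableT_comp => //.
    exact: measurable_funM.
  - by apply/measurable_EFinP; exact: measurable_funM.
  - move=> s _; rewrite -EFinM lee_fin normrM (ger0_norm (p0 s)) mulrC.
    by rewrite ler_wpM2r.
rewrite ge0_integralZl_EFin//; last first.
- exact/measurable_EFinP.
- by move=> s _; rewrite lee_fin.
by rewrite -[leRHS]mule1 lee_wpmul2l// lee_fin.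
Qed.

Lemma expectation_integrable : mu.-integrable setT (EFin \o (fun s => p s * u s)).
Proof.
have [mp p0 p1] := hp; apply: (integrable_le_fin _ _ M).
  exact: measurable_funM.
exact: expectation_integral_le.
Qed.

Lemma expectation_le : `|\int[mu]_s (p s * u s)| <= M.
Proof.
have [mp p0 p1] := hp; apply: Rintegral_norm_le; first exact: measurable_funM.
exact: expectation_integral_le.
Qed.

End expectation.

Lemma expectation_dist_le (p q u v : S -> R) (M c e : R) :
  subprob mu p -> subprob mu q ->
  measurable_fun setT u -> measurable_fun setT v ->
  (forall s, `|u s| <= M) -> (forall s, `|v s| <= M) ->
  (forall s, `|u s - v s| <= c) -> (\int[mu]_s `|p s - q s|%:E <= e%:E)%E ->
  `|\int[mu]_s (p s * u s) - \int[mu]_s (q s * v s)| <= c + M * e.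
Proof.
move=> hp hq mu_ mv uM vM uvc pqe.
have M0 : 0 <= M by exact: le_trans (normr_ge0 _) (uM (nseq_tuple _ 0)).
have c0 : 0 <= c by exact: le_trans (normr_ge0 _) (uvc (nseq_tuple _ 0)).
rewrite -RintegralB//; [|exact: (expectation_integrable _ _ M)|
  exact: (expectation_integrable _ _ M)].
have [mp p0 p1] := hp; have [mq q0 q1] := hq.
have mD : measurable_fun setT (fun s => `|p s - q s|).
  by apply: measurableT_comp => //; exact: measurable_funB.
apply: Rintegral_norm_le; first by apply: measurable_funB; exact: measurable_funM.
apply: (@le_trans _ _
  (\int[mu]_s (c%:E * (p s)%:E + M%:E * `|p s - q s|%:E))%E).
  apply: ge0_le_integral => //.
  - apply/measurable_EFinP; apply: measurableT_comp => //.
    by apply: measurable_funB; exact: measurable_funM.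
  - by apply: emeasurable_funD; apply/measurable_EFinP; exact: measurable_funM.
  - move=> s _; rewrite -!EFinM -EFinD lee_fin.
    (* The mass of [p] absorbs the first term, which costs [c]; the uniform bound on [v] makes the
       second cost [M * e]. *)
    have -> : p s * u s - q s * v s = p s * (u s - v s) + v s * (p s - q s) by ring.
    rewrite (le_trans (ler_normD _ _))// !normrM (ger0_norm (p0 s)) mulrC.
    by rewrite lerD// ler_wpM2r.
rewrite ge0_integralD//; last first.
- by apply/measurable_EFinP; exact: measurable_funM.
- by move=> s _; rewrite mule_ge0// lee_fin.
- by apply/measurable_EFinP; exact: measurable_funM.
- by move=> s _; rewrite mule_ge0// lee_fin.
rewrite !ge0_integralZl_EFin//; last first.
- exact/measurable_EFinP.
- by move=> s _; rewrite lee_fin.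
- exact/measurable_EFinP.
rewrite EFinD leeD//; first by rewrite -[leRHS]mule1 lee_wpmul2l// lee_fin.
by rewrite EFinM lee_wpmul2l// lee_fin.
Qed.

End reward_gap.

(** * Geometric sums and discounting *)

Section discounting.
Context {R : realType}.
Variable gamma : R.
Hypothesis gamma01 : 0 <= gamma < 1.

Lemma sum_geometric_le (N : nat) :
  \sum_(0 <= t < N) gamma ^+ t <= (1 - gamma)^-1.
Proof.
have /andP[g0 g1] := gamma01; have h : 0 < 1 - gamma by rewrite subr_gt0.
rewrite -[leRHS]mul1r ler_pdivlMr//.
suff -> : (\sum_(0 <= t < N) gamma ^+ t) * (1 - gamma) = 1 - gamma ^+ N.
  by rewrite lerBlDr lerDl exprn_ge0.
elim: N => [|N IH]; first by rewrite big_nil mul0r expr0 subrr.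
by rewrite big_nat_recr//= mulrDl IH exprS; ring.
Qed.

Lemma sum_arith_geometric_le (N : nat) :
  \sum_(0 <= t < N) t%:R * gamma ^+ t <= gamma / (1 - gamma) ^+ 2.
Proof.
have /andP[g0 g1] := gamma01; have h : 0 < 1 - gamma by rewrite subr_gt0.
rewrite ler_pdivlMr ?exprn_gt0//.
(* The exact partial sum falls short of the limit by a nonnegative remainder, so the bound is
   uniform in [N]. *)
suff -> : (\sum_(0 <= t < N) t%:R * gamma ^+ t) * (1 - gamma) ^+ 2 =
    gamma - gamma ^+ N * (N%:R * (1 - gamma) + gamma).
  rewrite lerBlDr lerDl mulr_ge0 ?exprn_ge0// addr_ge0// mulr_ge0//.
  exact: ltW.
elim: N => [|N IH]; first by rewrite big_nil expr0 mulr0n; ring.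
by rewrite big_nat_recr//= mulrDl IH [gamma ^+ N.+1]exprS -natr1; ring.
Qed.

(** The infinite-horizon sum is a [limn], informative only once convergence is known; domination by
    a geometric series provides it. *)
Lemma is_cvg_discounted (u : nat -> R) (M : R) : (forall t, `|u t| <= M) ->
  cvgn (fun N => \sum_(0 <= t < N) gamma ^+ t * u t).
Proof.
move=> uM; have /andP[g0 g1] := gamma01.
have M0 : 0 <= M by exact: le_trans (normr_ge0 _) (uM 0).
apply: (@normed_cvg R R^o (fun t => gamma ^+ t * u t)).
apply: (@series_le_cvg _ _ (geometric M gamma)).
- by move=> t; exact: normr_ge0.
- by move=> t; rewrite /geometric mulr_ge0// exprn_ge0.
- move=> t; rewrite /geometric /= normrM (ger0_norm (exprn_ge0 _ g0)) mulrC.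
  by rewrite ler_wpM2r// exprn_ge0.
- by apply: is_cvg_geometric_series; rewrite ger0_norm.
Qed.

Lemma discounted_sum_dist_le (T : option nat) (u v : nat -> R) (M A B : R) :
  (forall t, `|u t| <= M) -> (forall t, `|v t| <= M) ->
  0 <= A -> 0 <= B -> (forall t, `|u t - v t| <= B + t%:R * A) ->
  `|discounted_sum T gamma u - discounted_sum T gamma v| <=
  gamma * A / (1 - gamma) ^+ 2 + B / (1 - gamma).
Proof.
move=> uM vM A0 B0 uv; have /andP[g0 g1] := gamma01.
(* One bound for all partial sums serves both horizons: take [N = T.+1] when the horizon is finite,
   and pass to the limit otherwise. *)
have fin N : `|\sum_(0 <= t < N) gamma ^+ t * u t -
    \sum_(0 <= t < N) gamma ^+ t * v t| <=
    gamma * A / (1 - gamma) ^+ 2 + B / (1 - gamma).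
  rewrite -sumrB (le_trans (ler_norm_sum _ _ _))//.
  apply: (@le_trans _ _ (A * (\sum_(0 <= t < N) t%:R * gamma ^+ t) +
      B * (\sum_(0 <= t < N) gamma ^+ t))).
    rewrite !mulr_sumr -big_split/=; apply: ler_sum => t _.
    rewrite -mulrBr normrM (ger0_norm (exprn_ge0 _ g0)).
    rewrite (le_trans (ler_wpM2l (exprn_ge0 _ g0) (uv t)))//.
    by rewrite le_eqVlt; apply/orP; left; apply/eqP; ring.
  rewrite lerD// ?ler_wpM2l ?sum_geometric_le//.
  by rewrite [gamma * A]mulrC -mulrA ler_wpM2l// sum_arith_geometric_le.
case: T => [T|] /=; first exact: fin.
have cu := is_cvg_discounted u M uM; have cv := is_cvg_discounted v M vM.
rewrite -limB// -lim_norm; last exact: is_cvgB.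
apply: limr_le; first by apply: is_cvg_norm; exact: is_cvgB.
by apply: nearW => N; exact: fin.
Qed.

End discounting.

(** * From policy and kernel gaps to returns, and the effect of pruning on the network *)

Section policy_gap.
Context {R : realType} {n : nat}.
Local Notation S := (n.-tuple R).

Lemma J_dist_le (mu : {sigma_finite_measure set S -> \bar R})
    (P : S -> R -> S -> R) (p0 : S -> R) (r : S -> R -> R) (M gamma : R)
    (T : option nat) (pi pi' : S -> R -> R) (delta c : R) :
  measurable_fun setT (fun x : (S * R) * S => P x.1.1 x.1.2 x.2) ->
  (forall s a s', 0 <= P s a s') ->
  (forall s a, (\int[mu]_s' (P s a s')%:E <= 1)%E) ->
  subprob mu p0 -> subpolicy pi -> subpolicy pi' ->
  measurable_fun setT (fun x : S * R => r x.1 x.2) ->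
  (forall s a, `|r s a| <= M) -> 0 <= gamma < 1 -> 0 <= delta ->
  (forall t, \int[mu]_s (state_dist mu p0 (induced_kernel P pi) t s *
     TV mu (induced_kernel P pi s) (induced_kernel P pi' s)) <= delta) ->
  (forall s, `|\int[lebesgue_measure]_a (pi s a * r s a) -
     \int[lebesgue_measure]_a (pi' s a * r s a)| <= c) ->
  `|J mu T gamma p0 P r pi - J mu T gamma p0 P r pi'| <=
  gamma * (M * (2 * delta)) / (1 - gamma) ^+ 2 + c / (1 - gamma).
Proof.
move=> mP P0 P1 hp0 hpi hpi' mr rM g01 d0 hdelta hc.
have hk := substoch_induced_kernel mu P pi mP P0 P1 hpi.
have hk' := substoch_induced_kernel mu P pi' mP P0 P1 hpi'.
have M0 : 0 <= M by exact: le_trans (normr_ge0 _) (rM (nseq_tuple _ 0) 0).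
have hpt t := subprob_state_dist mu _ _ t hk hp0.
have hpt' t := subprob_state_dist mu _ _ t hk' hp0.
have mR := measurable_mean_reward pi r hpi mr.
have mR' := measurable_mean_reward pi' r hpi' mr.
have RM s := mean_reward_le pi r M hpi mr rM s.
have RM' s := mean_reward_le pi' r M hpi' mr rM s.
apply: (discounted_sum_dist_le gamma g01 T _ _ M).
- by move=> t; exact: expectation_le.
- by move=> t; exact: expectation_le.
- by rewrite mulr_ge0// mulr_ge0.
- exact: le_trans (normr_ge0 _) (hc (nseq_tuple _ 0)).
(* At time [t] the state laws are at L^1 distance at most [t * (2 * delta)], the factor 2 turning
   [TV] into an L^1 norm; [M] bounds the mean reward. *)
- move=> t; rewrite mulrCA; apply: expectation_dist_le => //.
  apply: state_dist_dist_le => // t'.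
  exact: integral_TV_le.
Qed.

Lemma measurable_cube : measurable (@cube R n).
Proof.
rewrite (_ : cube = \bigcap_(k in [set: 'I_n])
    ((fun s : S => tnth s k) @^-1` `[0, 1]%classic)).
  apply: fin_bigcap_measurable => // k _.
  by rewrite -[X in measurable X]setTI; exact: measurable_tnth.
by apply/seteqP; split => s /= h k; [move=> _|]; have := h k;
  rewrite /= in_itv/=; [exact|exact].
Qed.

Lemma measurable_sum_fun {dT : measure_display} {T : measurableType dT}
    (I : Type) (l : seq I) (h : I -> T -> R) :
  (forall i, measurable_fun setT (h i)) ->
  measurable_fun setT (fun x => \sum_(i <- l) h i x).
Proof.
move=> mh; elim: l => [|i l IH].
  by under eq_fun do rewrite big_nil; exact: measurable_cst.
by under eq_fun do rewrite big_cons; exact: measurable_funD.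
Qed.

Lemma measurable_lipschitz (phi : R -> R) (L : R) :
  (forall x y, `|phi x - phi y| <= L * `|x - y|) -> measurable_fun setT phi.
Proof.
move=> hL.
have L0 : 0 <= L.
  by have := hL 0 1; rewrite sub0r normrN normr1 mulr1; exact: le_trans.
apply: continuous_measurable_fun => x; apply/cvgrPdist_le => e e0.
(* [L] may be 0, so the radius is [e / (L + 1)]. *)
have L1 : 0 < L + 1 by rewrite ltr_wpDl.
near=> y; rewrite (le_trans (hL x y))//.
apply: (@le_trans _ _ ((L + 1) * (e / (L + 1)))).
  rewrite ler_pM ?lerDl//.
  by near: y; apply: cvgr_dist_le; [exact: cvg_id|rewrite divr_gt0].
by rewrite mulrCA divff ?mulr1// gt_eqF.
Unshelve. all: by end_near.
Qed.

Lemma measurable_net (H : nat) (phi : R -> R) (W1 : 'I_H -> 'I_n -> R)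
    (b1 : 'I_H -> R) (W2 : 'I_H -> R) (b2 : R) :
  measurable_fun setT phi -> measurable_fun setT (net phi W1 b1 W2 b2).
Proof.
move=> mphi; apply: measurable_funD => //; apply: measurable_sum_fun => i.
apply: measurable_funM => //; apply: measurableT_comp => //.
apply: measurable_funD => //; apply: measurable_sum_fun => k.
by apply: measurable_funM => //; exact: measurable_tnth.
Qed.

Lemma subpolicy_gauss (m : S -> R) (sig : R) : sig != 0 ->
  measurable_fun setT m -> subpolicy (gauss_policy m sig).
Proof.
move=> s0 mm; split.
- rewrite (_ : (fun x => _) = fun x : S * R => normal_peak sig *
    expR (- (x.2 - m x.1) ^+ 2 / (sig ^+ 2 *+ 2))); last first.
    by apply/funext => x; rewrite /gauss_policy normal_pdfE.
  apply: measurable_funM => //; apply: measurableT_comp => //.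
  apply: measurable_funM => //; apply: measurableT_comp => //.
  apply: measurable_funX; apply: measurable_funB; first exact: measurable_snd.
  by apply: measurableT_comp => //; exact: measurable_fst.
- by move=> s a; exact: normal_pdf_ge0.
- by move=> s; rewrite integral_normal_pdf.
Qed.

(** In hidden unit [i] the two pre-activations differ only by [W1 i j] times the [j]-th coordinate,
    which lies in [[0, 1]] on the cube. *)
Lemma net_prune_dist_le (H : nat) (phi : R -> R) (L : R)
    (W1 : 'I_H -> 'I_n -> R) (b1 : 'I_H -> R) (W2 : 'I_H -> R) (b2 : R)
    (j : 'I_n) (s : S) :
  (forall x y, `|phi x - phi y| <= L * `|x - y|) -> cube s ->
  `|net phi W1 b1 W2 b2 s - net phi (prune W1 j) b1 W2 b2 s| <=
  L * \sum_(i < H) `|W2 i * W1 i j|.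
Proof.
move=> hL cs.
have L0 : 0 <= L.
  by have := hL 0 1; rewrite sub0r normrN normr1 mulr1; exact: le_trans.
rewrite /net opprD addrACA subrr addr0 -sumrB.
rewrite (le_trans (ler_norm_sum _ _ _))// mulr_sumr; apply: ler_sum => i _.
rewrite -mulrBr !normrM mulrCA ler_wpM2l//.
rewrite (le_trans (hL _ _))// ler_wpM2l//.
rewrite opprD addrACA subrr addr0 -sumrB (bigD1 j)//= big1 ?addr0.
  rewrite /prune eqxx mul0r subr0 normrM ler_piMr//.
  by have /andP[s0 s1] := cs j; rewrite ger0_norm.
by move=> k /negbTE kj; rewrite /prune kj subrr.
Qed.

(** The two claims go through one induction: the laws agree at the next time because the current one
    vanishes where the kernels may differ. *)
Lemma state_dist_eq_cube (mu : {measure set S -> \bar R}) (p0 : S -> R)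
    (k k' : S -> S -> R) t :
  (forall s, ~ cube s -> p0 s = 0) -> (forall s, cube s -> k s = k' s) ->
  (forall s s', cube s -> ~ cube s' -> k s s' = 0) ->
  state_dist mu p0 k t = state_dist mu p0 k' t /\
  forall s, ~ cube s -> state_dist mu p0 k t s = 0.
Proof.
move=> p00 kk' k0; elim: t => [//|t [IHe IH0]] /=; split.
  apply/funext => s'; apply: eq_Rintegral => s _; rewrite -IHe.
  have [cs|cs] := pselect (cube s); first by rewrite kk'.
  by rewrite IH0// !mulr0.
move=> s' cs'; apply: Rintegral_eq0 => s; have [cs|cs] := pselect (cube s); first by rewrite k0// mul0r.
by rewrite IH0// mulr0.
Qed.

End policy_gap.

(** * Cutting the transition density and the reward off outside the cube *)

Section cube_restriction.
Context {R : realType} {n : nat}.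
Local Notation S := (n.-tuple R).

(** The second argument has arbitrary type so that one construction serves rewards, with [U] the
    actions, and transition densities, with [U] the pairs of an action and a next state. *)
Definition cube_restr {U : Type} (f : S -> U -> R) (s : S) (x : U) : R :=
  \1_cube s * f s x.

Lemma cube_restr_in U (f : S -> U -> R) s : cube s -> cube_restr f s = f s.
Proof.
by move=> cs; apply/funext => x; rewrite /cube_restr indicE mem_set// mul1r.
Qed.

Lemma cube_restr_out U (f : S -> U -> R) s x : ~ cube s -> cube_restr f s x = 0.
Proof. by move=> cs; rewrite /cube_restr indicE memNset// mul0r. Qed.

Lemma measurable_cube_indic {dT : measure_display} {T : measurableType dT}
    (g : T -> S) :
  measurable_fun setT g -> measurable_fun setT (fun x => \1_cube (g x) : R).
Proof.
move=> mg; apply: measurableT_comp => //.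
by apply: measurable_indic; exact: measurable_cube.
Qed.

Definition kernel_restr (P : S -> R -> S -> R) (s : S) (a : R) (s' : S) : R :=
  cube_restr (fun s x => P s x.1 x.2) s (a, s').

Lemma induced_kernel_restr (P : S -> R -> S -> R) pi s : cube s ->
  induced_kernel P pi s = induced_kernel (kernel_restr P) pi s.
Proof.
by move=> cs; apply/funext => s'; apply: eq_Rintegral => a _;
  rewrite /kernel_restr cube_restr_in.
Qed.

Lemma induced_kernel_out (P : S -> R -> S -> R) pi s s' :
  (forall a, P s a s' = 0) -> induced_kernel P pi s s' = 0.
Proof.
by move=> P0; apply: Rintegral_eq0 => a; rewrite P0 mul0r.
Qed.

Lemma J_restr (mu : {measure set S -> \bar R}) (T : option nat) (gamma : R)
    (p0 : S -> R) (P : S -> R -> S -> R) (r : S -> R -> R) (pi : S -> R -> R) :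
  (forall s, ~ cube s -> p0 s = 0) ->
  (forall s a s', cube s -> ~ cube s' -> P s a s' = 0) ->
  J mu T gamma p0 P r pi = J mu T gamma p0 (kernel_restr P) (cube_restr r) pi.
Proof.
move=> p00 P00; rewrite /J; apply: f_equal; apply/funext => t.
have [e e0] := state_dist_eq_cube mu p0 (induced_kernel P pi)
  (induced_kernel (kernel_restr P) pi) t p00 (induced_kernel_restr P pi)
  (fun s s' cs cs' => induced_kernel_out P pi s s' (fun a => P00 s a s' cs cs')).
apply: eq_Rintegral => s _; rewrite -e.
have [cs|cs] := pselect (cube s); first by rewrite cube_restr_in.
by rewrite (e0 s cs) [LHS]mul0r [RHS]mul0r.
Qed.

End cube_restriction.

(** Tonelli is used for bundled sigma-finite measures. The equality of underlying measures allows
    [mu] to be replaced by its bundled form throughout a statement. *)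
Lemma sigma_finite_measureP {dT : measure_display} {T : measurableType dT}
    {R : realType} (mu : {measure set T -> \bar R}) : sigma_finite setT mu ->
  exists nu : {sigma_finite_measure set T -> \bar R},
    (nu : {measure set T -> \bar R}) = mu.
Proof.
case: mu => m mc; set mu := Measure.Pack mc => sf.
pose h := isSigmaFinite.Build _ _ _ (Measure.sort mu) sf.
pose h' := isSFinite.Build _ _ _ (Measure.sort mu)
  (sfinite_measure_sigma_finite sf).
by exists (HB.pack_for (SigmaFiniteMeasure.type T R) (Measure.sort mu) h h').
Qed.

(** * The performance gap between a Gaussian policy and its pruned version *)

Theorem theorem1 (R : realType) (d : nat)
  (mu : {measure set (d.-tuple R) -> \bar R})
  (P : d.-tuple R -> R -> d.-tuple R -> R)
  (p0 : d.-tuple R -> R)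
  (r : d.-tuple R -> R -> R) (rmin rmax : R)
  (gamma : R) (T : option nat)
  (H : nat) (phi : R -> R) (a b Lphi : R)
  (W1 : 'I_H -> 'I_d -> R) (b1 : 'I_H -> R) (W2 : 'I_H -> R) (b2 : R)
  (j : 'I_d) (sigf delta : R) :
  (* reference measure on the state space (Lebesgue "ds" in the paper) *)
  sigma_finite setT mu ->
  (* transition density P(s' | s, a) on S = [0,1]^d *)
  measurable_fun setT (fun x : (d.-tuple R * R) * d.-tuple R => P x.1.1 x.1.2 x.2) ->
  (forall s a s', cube s -> 0 <= P s a s') ->
  (forall s a s', cube s -> ~ cube s' -> P s a s' = 0) ->
  (forall s a, cube s -> (\int[mu]_(s' in setT) (P s a s')%:E = 1)%E) ->
  (* initial state density p^0 (common to both processes) *)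
  measurable_fun setT p0 ->
  (forall s, 0 <= p0 s) ->
  (forall s, ~ cube s -> p0 s = 0) ->
  (\int[mu]_(s in setT) (p0 s)%:E = 1)%E ->
  (* reward r : S x A -> [rmin, rmax], |r| <= rmax *)
  measurable_fun setT (fun x : d.-tuple R * R => r x.1 x.2) ->
  (forall s a, cube s -> rmin <= r s a <= rmax) ->
  (forall s a, cube s -> `|r s a| <= rmax) ->
  (* discount *)
  0 <= gamma < 1 ->
  (* activation phi : R -> (a,b), L_phi-Lipschitz *)
  (forall x, a < phi x < b) ->
  (forall x y, `|phi x - phi y| <= Lphi * `|x - y|) ->
  0 < sigf ->
  0 <= delta ->
  (let pi1 := gauss_policy (net phi W1 b1 W2 b2) sigf in
   let pi2 := gauss_policy (net phi (prune W1 j) b1 W2 b2) sigf in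
   let k1 := induced_kernel P pi1 in
   let k2 := induced_kernel P pi2 in
   (forall t : nat,
      \int[mu]_(s in setT)
         (state_dist mu p0 k1 t s * TV mu (k1 s) (k2 s)) <= delta) ->
   `|J mu T gamma p0 P r pi1 - J mu T gamma p0 P r pi2|
     <= 2 * rmax * (gamma * delta / (1 - gamma) ^+ 2
                    + (Lphi * \sum_(i < H) `|W2 i * W1 i j|) / (sigf * (1 - gamma)))).
Proof.
move=> /sigma_finite_measureP[{}mu <-] mP P0 P00 P1 mp0 p00 p0c p01 mr _ rM g01 _
  phiL s0 d0 pi1 pi2 k1 k2 hdelta.
have sn0 : sigf != 0 by rewrite gt_eqF.
(* The reward and network bounds hold on the cube only, so the signs of [rmax] and [B] are read off
   at the origin. *)
have c0 : @cube R d (nseq_tuple _ 0).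
  by move=> k; rewrite tnth_nseq lexx ler01.
have M0 : 0 <= rmax by exact: le_trans (normr_ge0 _) (rM _ 0 c0).
have mphi := measurable_lipschitz phi Lphi phiL.
have hpi1 : subpolicy pi1 by apply: subpolicy_gauss => //; exact: measurable_net.
have hpi2 : subpolicy pi2 by apply: subpolicy_gauss => //; exact: measurable_net.
set B := Lphi * _.
have B0 : 0 <= B.
  exact: le_trans (normr_ge0 _) (net_prune_dist_le _ _ _ W1 b1 W2 b2 j _ phiL c0).
rewrite !(J_restr mu T gamma p0 P r)//.
(* The estimate gives the pruning term with factor [rmax], half of the claimed one; the surplus [X0]
   is nonnegative. *)
apply: (@le_trans _ _ (gamma * (rmax * (2 * delta)) / (1 - gamma) ^+ 2
    + rmax * (B / sigf) / (1 - gamma))); last first.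
  have /andP[g0 g1] := g01; have h : 0 < 1 - gamma by rewrite subr_gt0.
  have X0 : 0 <= rmax * (B / sigf) / (1 - gamma).
    by rewrite divr_ge0 ?(ltW h)// mulr_ge0// divr_ge0// ltW.
  have -> : 2 * rmax * (gamma * delta / (1 - gamma) ^+ 2 + B / (sigf * (1 - gamma)))
      = gamma * (rmax * (2 * delta)) / (1 - gamma) ^+ 2
      + rmax * (B / sigf) / (1 - gamma) + rmax * (B / sigf) / (1 - gamma).
    by field; rewrite sn0 gt_eqF.
  by rewrite lerDl.
have r'M s x : `|cube_restr r s x| <= rmax.
  have [cs|cs] := pselect (cube s); first by rewrite cube_restr_in// rM.
  by rewrite cube_restr_out// normr0.
have mr' : measurable_fun setT (fun x : d.-tuple R * R => cube_restr r x.1 x.2).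
  by apply: measurable_funM => //; apply: measurable_cube_indic; exact: measurable_fst.
apply: (J_dist_le mu (kernel_restr P) p0 (cube_restr r) rmax gamma T pi1 pi2
  delta (rmax * (B / sigf)) _ _ _ _ hpi1 hpi2 mr' r'M g01 d0).
- apply: measurable_funM => //; apply: measurable_cube_indic.
  exact: (measurableT_comp measurable_fst measurable_fst).
- move=> s x s'; rewrite /kernel_restr.
  have [cs|cs] := pselect (cube s); first by rewrite cube_restr_in// P0.
  by rewrite cube_restr_out.
- move=> s x; rewrite /kernel_restr.
  have [cs|cs] := pselect (cube s).
    by under eq_integral do rewrite cube_restr_in//=; rewrite P1.
  by under eq_integral do rewrite cube_restr_out//=; rewrite integral0.
- by split=> //; rewrite p01.
(* The assumption on [delta] concerns the original [P]. It carries over with equality: on the cube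
   the kernels agree, and off it the state law is 0. *)
- move=> t; apply: le_trans (hdelta t); rewrite le_eqVlt; apply/orP; left; apply/eqP.
  have [e e0] := state_dist_eq_cube mu p0 k1 (induced_kernel (kernel_restr P) pi1)
    t p0c (induced_kernel_restr P pi1) (fun s s' cs cs' =>
      induced_kernel_out P pi1 s s' (fun x => P00 s x s' cs cs')).
  apply: eq_Rintegral => s _; rewrite -e.
  have [cs|cs] := pselect (cube s); last by rewrite (e0 s cs) [LHS]mul0r [RHS]mul0r.
  rewrite /k1 /k2 (induced_kernel_restr P pi1 s cs).
  by rewrite (induced_kernel_restr P pi2 s cs).
- move=> s; have [cs|cs] := pselect (cube s).
    apply: mean_reward_dist_le => //.
    apply: le_trans (integral_normal_pdf_dist_le _ _ _ s0) _.
    rewrite lee_fin ler_pM2r ?invr_gt0//.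
    exact: net_prune_dist_le.
  (* Off the cube the means of the two policies may be far apart, but the truncated reward makes
     both mean rewards 0. *)
  have R0 pi : \int[lebesgue_measure]_x (pi s x * cube_restr r s x) = 0.
    by apply: Rintegral_eq0 => x; rewrite (cube_restr_out _ _ _ _ cs) mulr0.
  by rewrite (R0 pi1) (R0 pi2) subrr normr0 mulr_ge0// divr_ge0// ltW.
Qed.
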